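(* Let $R$ be a discrete valuation ring with field of fractions $K$, uniformizer $\pi$ and residue field $k=R/\pi R$. Let $A$ be an $R$-algebra with an $R$-linear involution $a\mapsto a^*$ (so $a^{**}=a$, $(ab)^*=b^*a^*$), and let $V$ be a finite-dimensional $K$-vector space which is an $A$-module via an $R$-bilinear map $A\times V\to V$, such that there exists a lattice $L$ of $V$ with $A\cdot L\subset L$. Let $B$ be a nondegenerate $K$-bilinear form on $V$ such that $B(ax,y)=B(x,a^*y)$ for all $a\in A$, $x,y\in V$, and assume either that $B$ is alternating, or that $B$ is symmetric and $\mathrm{char}(k)\neq 2$. Let $A_k=A/\pi A$ with the induced involution, and let $V_k$ be the reduction mod $\pi$ of $V$. Then there exists a nondegenerate $k$-bilinear form $b$ on $V_k$ such that $b(ax,y)=b(x,a^*y)$ for all $a\in A_k$, $x,y\in V_k$, and which is alternating (resp. symmetric) if $B$ is alternating (resp. symmetric).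
   Context: A lattice of $V$ is a free $R$-submodule $L$ with $K\otimes_R L\to V$ an isomorphism; an $A$-lattice is a lattice $L$ with $A\cdot L\subset L$. For an $A$-lattice $L$, $L/\pi L$ is an $A_k$-module; its semisimplification (direct sum of the Jordan–Hölder quotients) is, up to isomorphism, independent of the $A$-lattice $L$; this $A_k$-module is denoted $V_k$. *)

(* Defs.v *)
From HB Require Import structures.
From mathcomp Require Import all_boot all_order all_algebra.
Set Implicit Arguments. Unset Strict Implicit. Unset Printing Implicit Defensive.
Import Order.TTheory GRing.Theory Num.Theory.
Local Open Scope ring_scope.

Definition is_dvr_unif (R : idomainType) (pi : R) : Prop :=
  [/\ pi != 0, pi \isn't a GRing.unit &
      forall r : R, r != 0 ->
        exists (u : R) (n : nat), u \is a GRing.unit /\ r = u * pi ^+ n].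

Definition is_frac_field (R : idomainType) (K : fieldType)
    (j : {rmorphism R -> K}) : Prop :=
  injective j /\ forall x : K, exists a b : R, b != 0 /\ x = j a / j b.

Definition is_residue_field (R : idomainType) (k : fieldType)
    (red : {rmorphism R -> k}) (pi : R) : Prop :=
  (forall c : k, exists r : R, red r = c) /\
  (forall r : R, red r = 0 <-> exists s : R, r = pi * s).

Definition is_involution (R : comNzRingType) (A : algType R) (star : A -> A)
  : Prop :=
  [/\ forall a, star (star a) = a,
      forall a b, star (a * b) = star b * star a,
      forall a b, star (a + b) = star a + star b &
      forall (r : R) a, star (r *: a) = r *: star a].

Definition is_Rbilinear_module (R : comNzRingType) (K : fieldType)
    (j : R -> K) (A : algType R) (V : lmodType K) (act : A -> V -> V) : Prop :=
  (forall a b v, act (a + b) v = act a v + act b v) /\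
  (forall a v w, act a (v + w) = act a v + act a w) /\
  (forall (r : R) a v, act (r *: a) v = j r *: act a v) /\
  (forall (r : R) a v, act a (j r *: v) = j r *: act a v) /\
  (forall v, act 1 v = v) /\
  (forall a b v, act (a * b) v = act a (act b v)).

(* A k-vector space W which is an A_k = A / pi A module: an A-module
   structure, k-linear, on which r in R acts through red. *)
Definition is_Ak_module (R : comNzRingType) (k : fieldType)
    (red : R -> k) (A : algType R) (W : lmodType k) (act : A -> W -> W) : Prop :=
  [/\ forall a b w, act (a + b) w = act a w + act b w,
      forall a (c : k) v w, act a (c *: v + w) = c *: act a v + act a w,
      forall (r : R) a w, act (r *: a) w = red r *: act a w,
      forall w, act 1 w = w &
      forall a b w, act (a * b) w = act a (act b w)].

Definition Rspan (R : comNzRingType) (K : fieldType) (j : R -> K)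
    (V : vectType K) (e : seq V) : V -> Prop :=
  fun v => exists c : 'I_(size e) -> R, v = \sum_(i < size e) j (c i) *: e`_i.

(* A lattice of V: a free R-submodule L such that K (x)_R L -> V is an
   isomorphism, i.e. the R-span of an R-basis of L which is a K-basis of V. *)
Definition is_lattice (R : comNzRingType) (K : fieldType) (j : R -> K)
    (V : vectType K) (L : V -> Prop) : Prop :=
  exists e : seq V, basis_of fullv e /\ forall v, L v <-> Rspan j e v.

Definition is_A_lattice (R : comNzRingType) (K : fieldType) (j : R -> K)
    (A : algType R) (V : vectType K) (act : A -> V -> V) (L : V -> Prop) : Prop :=
  is_lattice j L /\ forall a v, L v -> L (act a v).

(* (M, actM) is L / pi L as an A_k-module, via the reduction map q : L -> M
   (q is an R-linear, A-equivariant surjection from L with kernel pi L). *)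
Definition is_reduction (R : comNzRingType) (K k : fieldType) (j : R -> K)
    (red : R -> k) (pi : R) (A : algType R) (V : vectType K)
    (act : A -> V -> V) (L : V -> Prop)
    (M : vectType k) (actM : A -> M -> M) (q : V -> M) : Prop :=
  [/\ forall x y, L x -> L y -> q (x + y) = q x + q y,
      forall (r : R) x, L x -> q (j r *: x) = red r *: q x,
      forall a x, L x -> q (act a x) = actM a (q x),
      forall m : M, exists x, L x /\ q x = m &
      forall x, L x -> (q x = 0 <-> exists y, L y /\ x = j pi *: y)].

Definition Astable (R : comNzRingType) (k : fieldType) (A : algType R)
    (M : vectType k) (actM : A -> M -> M) (U : {vspace M}) : Prop :=
  forall a x, x \in U -> actM a x \in U.

(* (W, actW) is a semisimplification of (M, actM): there is a composition
   series 0 = M_0 < M_1 < ... < M_n = M of A-submodules with simple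
   quotients, and W is the direct sum of A-submodules W_0, ..., W_(n-1) with
   W_i isomorphic (as A-module) to M_(i+1) / M_i, the isomorphism being
   induced by a linear map f_i defined on M_(i+1) with kernel M_i. *)
Definition is_semisimplification (R : comNzRingType) (k : fieldType)
    (A : algType R) (M : vectType k) (actM : A -> M -> M)
    (W : vectType k) (actW : A -> W -> W) : Prop :=
  exists (n : nat) (Ms : nat -> {vspace M}) (Ws : 'I_n -> {vspace W})
         (f : 'I_n -> 'Hom(M, W)),
  Ms 0%N = 0%VS /\ Ms n = fullv /\
  (forall i, (i <= n)%N -> Astable actM (Ms i)) /\
  (forall i, (i < n)%N -> (Ms i <= Ms i.+1)%VS && (Ms i != Ms i.+1)) /\
  (forall i, (i < n)%N -> forall U : {vspace M}, Astable actM U ->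
      (Ms i <= U)%VS -> (U <= Ms i.+1)%VS -> U = Ms i \/ U = Ms i.+1) /\
  (forall i : 'I_n, Astable actW (Ws i)) /\
  directv (\sum_(i < n) Ws i) /\ (\sum_(i < n) Ws i)%VS = fullv /\
  (forall i : 'I_n,
      (f i @: Ms i.+1)%VS = Ws i /\
      (lker (f i) :&: Ms i.+1)%VS = Ms i /\
      (forall a x, x \in Ms i.+1 -> f i (actM a x) = actW a (f i x))).

Definition bil_form (F : fieldType) (U : lmodType F) (b : U -> U -> F)
  : Prop :=
  (forall (c : F) x y z, b (c *: x + y) z = c * b x z + b y z) /\
  (forall (c : F) x y z, b x (c *: y + z) = c * b x y + b x z).

Definition nondeg_form (F : fieldType) (U : lmodType F) (b : U -> U -> F)
  : Prop :=
  (forall x, (forall y, b x y = 0) -> x = 0) /\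
  (forall y, (forall x, b x y = 0) -> y = 0).

Definition alt_form (F : fieldType) (U : lmodType F) (b : U -> U -> F)
  : Prop := forall x, b x x = 0.

Definition sym_form (F : fieldType) (U : lmodType F) (b : U -> U -> F)
  : Prop := forall x y, b x y = b y x.

Definition star_adjoint (R : comNzRingType) (F : fieldType) (A : algType R)
    (star : A -> A) (U : lmodType F) (act : A -> U -> U) (b : U -> U -> F)
  : Prop := forall a x y, b (act a x) y = b x (act (star a) y).

(* Main.v *)
(* Scale B so that it is integral on L, and let F 0 = pi L < F 1 < ... < F n = L
   be the preimage in L of the composition series of L / pi L. It extends to a
   periodic chain of A-lattices pi^m F i with simple quotients, and so does its
   dual chain. As for the relative position of two flags (Bruhat
   decomposition), each i has exactly one pair (i', m) such that pi^-m B induces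
   a nonzero, hence perfect, pairing of F i.+1 / F i with F i'.+1 / F i'. As B is
   symmetric up to sign, i |-> i' is an involution preserving m, and the sum of
   these pairings is the form b on the semisimplification of this particular
   L / pi L: no comparison between lattices is needed. *)
Require Import Defs.
From HB Require Import structures.
From mathcomp Require Import all_boot all_order all_algebra.
From mathcomp Require Import boolp.
Set Implicit Arguments. Unset Strict Implicit. Unset Printing Implicit Defensive.
Import GRing.Theory.
Local Open Scope ring_scope.

(** * Auxiliary facts on finite families and involutions *)

Lemma uniform_bound (I : finType) (P : I -> nat -> Prop) :
  (forall i m n, (m <= n)%N -> P i m -> P i n) ->
  (forall i, exists n, P i n) -> exists n, forall i, P i n.
Proof.
move=> P_mono /choice [f Pf]; exists (\max_i f i) => i.
by apply: P_mono (Pf i); apply: leq_bigmax.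
Qed.

Lemma nat_switch (P : nat -> Prop) N : P 0 -> ~ P N ->
  exists m, [/\ (m < N)%N, P m & ~ P m.+1].
Proof.
elim: N => [//|N IH] P0 nPN.
have [PN|nP] := pselect (P N); first by exists N.
by have [m [lt_m Pm nPm]] := IH P0 nP; exists m; split=> //; apply: ltnW.
Qed.

(** Terms over a two-element orbit of [s] cancel. At a fixed point the sign rule yields only
    [2 t i = 0], hence the separate vanishing hypothesis there, which makes the lemma usable in
    characteristic 2. *)
Lemma sum_involution (n : nat) (G : zmodType) (s : 'I_n -> 'I_n)
    (t : 'I_n -> G) :
  involutive s -> (forall i, t (s i) = - t i) ->
  (forall i, s i = i -> t i = 0) -> \sum_i t i = 0.
Proof.
move=> sK tN t0; rewrite (bigID (fun i : 'I_n => i < s i)%N) /=.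
rewrite [X in _ + X](bigID (fun i : 'I_n => s i < i)%N) /=.
rewrite [X in _ + (_ + X)]big1 ?addr0 => [|i]; last first.
  by rewrite -!leqNgt -eqn_leq => /eqP /val_inj /t0.
rewrite [X in _ + X](reindex_inj (inv_inj sK)) /=.
rewrite [X in _ + X](eq_big (fun i : 'I_n => i < s i)%N (fun i => - t i)) //.
  by rewrite sumrN subrr.
by move=> i; rewrite sK -leqNgt; case: ltngtP.
Qed.

(** * Bilinear forms over a field *)

Section BilinearForms.
Context {F : fieldType} {U : lmodType F} {b : U -> U -> F}.
Hypothesis b_bil : bil_form b.

Lemma bilDl x y z : b (x + y) z = b x z + b y z.
Proof. by have := b_bil.1 1 x y z; rewrite scale1r mul1r. Qed.

Lemma bilDr x y z : b x (y + z) = b x y + b x z.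
Proof. by have := b_bil.2 1 x y z; rewrite scale1r mul1r. Qed.

Lemma bil0l z : b 0 z = 0.
Proof. by apply: (addIr (b 0 z)); rewrite -bilDl !add0r. Qed.

Lemma bil0r z : b z 0 = 0.
Proof. by apply: (addIr (b z 0)); rewrite -bilDr !add0r. Qed.

Lemma bilZl c x z : b (c *: x) z = c * b x z.
Proof. by have := b_bil.1 c x 0 z; rewrite bil0l !addr0. Qed.

Lemma bilZr c x z : b x (c *: z) = c * b x z.
Proof. by have := b_bil.2 c x z 0; rewrite bil0r !addr0. Qed.

Lemma bilNl x z : b (- x) z = - b x z.
Proof. by rewrite -scaleN1r bilZl mulN1r. Qed.

Lemma bilNr x z : b x (- z) = - b x z.
Proof. by rewrite -scaleN1r bilZr mulN1r. Qed.

Lemma bilBl x y z : b (x - y) z = b x z - b y z.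
Proof. by rewrite bilDl bilNl. Qed.

Lemma bilBr x y z : b x (y - z) = b x y - b x z.
Proof. by rewrite bilDr bilNr. Qed.

Lemma bil_suml I (r : seq I) (f : I -> U) z :
  b (\sum_(i <- r) f i) z = \sum_(i <- r) b (f i) z.
Proof.
elim: r => [|i r IH]; first by rewrite !big_nil bil0l.
by rewrite !big_cons bilDl IH.
Qed.

Lemma alt_formN : alt_form b -> forall x y, b x y = - b y x.
Proof.
move=> alt_b x y; have := alt_b (x + y).
rewrite bilDl !bilDr !alt_b add0r addr0 => /eqP.
by rewrite addr_eq0 => /eqP.
Qed.

End BilinearForms.

(** By nondegeneracy [y |-> (b e_l y)_l] is injective, hence onto by dimension; [d] is a preimage of
    the [i]-th unit row. Coordinates thereby become values of the form. *)
Lemma dual_basis (F : fieldType) (U : vectType F) (b : U -> U -> F)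
    (e : seq U) :
  bil_form b -> nondeg_form b -> basis_of fullv e ->
  forall i : 'I_(size e), exists d, forall x, b x d = coord (in_tuple e) i x.
Proof.
move=> b_bil b_nd e_basis i.
have coordE x : x = \sum_(l < size e) coord (in_tuple e) l x *: e`_l.
  exact: (coord_basis (X := in_tuple e) e_basis (memvf x)).
pose phi := fun y : U => \row_(l < size e) b e`_l y.
have phi_linear : linear phi.
  by move=> c y z; apply/rowP => l; rewrite !mxE b_bil.2.
pose phiM := GRing.isLinear.Build F U 'rV[F]_(size e) _ phi phi_linear.
pose phiL : {linear U -> 'rV[F]_(size e)} := HB.pack phi phiM.
have phi_inj : lker (linfun phiL) == 0%VS.
  apply/eqP/vspaceP => y; rewrite memv_ker memv0 lfunE.
  apply/eqP/eqP => [|->]; last by rewrite linear0.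
  move=> /rowP phi0; apply: b_nd.2 => x; rewrite (coordE x) (bil_suml b_bil).
  rewrite big1 // => l _; rewrite (bilZl b_bil).
  by have := phi0 l; rewrite !mxE => ->; rewrite mulr0.
have phi_surj : limg (linfun phiL) = fullv.
  apply/eqP; rewrite eqEdim subvf /= limg_dim_eq ?(eqP phi_inj) ?capv0 //.
  by rewrite (size_basis (X := in_tuple e) e_basis) dimvf dim_matrix mul1r.
have /memv_imgP [d _ phi_d] : delta_mx 0 i \in limg (linfun phiL).
  by rewrite phi_surj memvf.
exists d => x; rewrite {1}(coordE x) (bil_suml b_bil) (bigD1 i) //=.
have bd (l : 'I_(size e)) : b e`_l d = (l == i)%:R.
  by move/rowP: phi_d => /(_ l); rewrite lfunE !mxE eqxx.
rewrite big1 => [|l /negbTE ne_li]; rewrite (bilZl b_bil) bd.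
  by rewrite eqxx mulr1 addr0.
by rewrite ne_li mulr0.
Qed.

(** * The valuation of [K], expressed through the submodules [pi^m R] *)

Definition dvdpi (R : nzRingType) (K : Type) (pi : R) (j : R -> K) m (x : K) :=
  exists r, x = j (pi ^+ m * r).

Section Dvr.
Context {R : idomainType} { pi : R} {K : fieldType} {j : {rmorphism R -> K}}.
Hypotheses (pi_unif : is_dvr_unif pi) (j_frac : is_frac_field j).

Lemma dvdpi0P x : dvdpi pi j 0 x <-> exists r, x = j r.
Proof. by split=> -[r ->]; exists r; rewrite mul1r. Qed.

Lemma j_pi_neq0 n : j (pi ^+ n) != 0.
Proof.
case: pi_unif => pi0 _ _; apply/eqP => jpi0.
have /eqP := j_frac.1 _ _ (etrans jpi0 (esym (rmorph0 j))).
by rewrite expf_eq0 (negPf pi0) andbF.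
Qed.

Lemma dvdpix0 m : dvdpi pi j m 0.
Proof. by exists 0; rewrite mulr0 rmorph0. Qed.

Lemma dvdpiD m x y : dvdpi pi j m x -> dvdpi pi j m y -> dvdpi pi j m (x + y).
Proof. by move=> [r ->] [s ->]; exists (r + s); rewrite mulrDr rmorphD. Qed.

Lemma dvdpiM m r x : dvdpi pi j m x -> dvdpi pi j m (j r * x).
Proof. by move=> [s ->]; exists (r * s); rewrite mulrCA !rmorphM. Qed.

Lemma dvdpiW m n x : (m <= n)%N -> dvdpi pi j n x -> dvdpi pi j m x.
Proof.
move=> le_mn [r ->]; exists (pi ^+ (n - m) * r).
by rewrite mulrA -exprD subnKC.
Qed.

Lemma dvdpi_mulX m n x : dvdpi pi j (m + n) (j (pi ^+ n) * x) <-> dvdpi pi j m x.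
Proof.
split=> [] [r xE]; exists r.
  apply: (mulfI (j_pi_neq0 n)); rewrite xE.
  by rewrite -rmorphM mulrA -exprD addnC.
by rewrite xE -rmorphM mulrA -exprD addnC.
Qed.

Lemma dvdpi_den x : exists s, dvdpi pi j 0 (j (pi ^+ s) * x).
Proof.
have [a [c [c0 ->]]] := j_frac.2 x; case: pi_unif => pi0 _ /(_ _ c0).
move=> [u [s [u_unit ->]]]; exists s; exists (u^-1 * a).
rewrite mul1r !rmorphM (rmorphV _ u_unit) invfM mulrCA [RHS]mulrC.
by congr (_ * _); rewrite mulrCA mulfV ?mulr1 // j_pi_neq0.
Qed.

(** The bound [s] makes the valuations of the [pi^s x] natural numbers, so a least one exists; an
    element attaining it divides all the others. *)
Lemma dvdpi_min (P : K -> Prop) s :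
  (forall x, P x -> dvdpi pi j 0 (j (pi ^+ s) * x)) ->
  (exists2 x, P x & x != 0) ->
  exists2 x, P x & x != 0 /\ forall y, P y -> dvdpi pi j 0 (y / x).
Proof.
move=> Ps [x0 Px0 x0n].
have valE x : P x -> x != 0 ->
    exists n u, u \is a GRing.unit /\ j (pi ^+ s) * x = j (u * pi ^+ n).
  move=> Px xn; have /dvdpi0P [r xr] := Ps _ Px.
  have rn : r != 0.
    apply: contraNneq xn => r0; move: xr; rewrite r0 rmorph0 => /eqP.
    by rewrite mulf_eq0 (negPf (j_pi_neq0 s)).
  case: pi_unif => _ _ /(_ _ rn) [u [n [uu rE]]].
  by exists n, u; rewrite xr rE.
pose Q n := `[< exists x u, [/\ P x, x != 0, u \is a GRing.unit &
  j (pi ^+ s) * x = j (u * pi ^+ n)] >].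
have exQ : exists n, Q n.
  by have [n [u [? ?]]] := valE _ Px0 x0n; exists n; apply/asboolP; exists x0, u.
case: (ex_minnP exQ) => n /asboolP [x [u [Px xn uu xE]]] n_min.
exists x => //; split=> // y Py; have [->|yn] := eqVneq y 0.
  by rewrite mul0r; apply: dvdpix0.
have [n' [v [vu yE]]] := valE _ Py yn.
have le_n : (n <= n')%N by apply: n_min; apply/asboolP; exists y, v.
apply/dvdpi0P; exists (u^-1 * v * pi ^+ (n' - n)).
apply: (canLR (mulfK xn)); apply: (mulfI (j_pi_neq0 s)).
rewrite mulrCA yE xE -rmorphM; congr (j _).
by rewrite mulrCA !mulrA divrr // mul1r -mulrA -exprD subnK.
Qed.

(** * Duality for [R]-submodules of [V] *)

Section Separation.
Context {V : vectType K} {B : V -> V -> K} {e : seq V}.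
Hypotheses (B_bil : bil_form B) (B_nd : nondeg_form B).
Hypothesis e_basis : basis_of fullv e.

Definition Rsubmod (j : R -> K) (N : V -> Prop) :=
  N 0 /\ forall r x y, N x -> N y -> N (j r *: x + y).

Lemma RsubmodD N x y : Rsubmod j N -> N x -> N y -> N (x + y).
Proof. by move=> [_ +] Nx Ny => /(_ 1 x y Nx Ny); rewrite rmorph1 scale1r. Qed.

Lemma RsubmodZ N r x : Rsubmod j N -> N x -> N (j r *: x).
Proof. by move=> [N0 +] Nx => /(_ r x 0 Nx N0); rewrite addr0. Qed.

Lemma RsubmodB N x y : Rsubmod j N -> N x -> N y -> N (x - y).
Proof.
move=> NR Nx Ny; rewrite addrC -scaleN1r -(rmorph1 j) -rmorphN.
exact: NR.2.
Qed.

(* N is reflexive: functionals integral on N are extended one coordinate at a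
   time, by projecting along a vector of N whose new coordinate divides all
   others. *)
Lemma separation N :
  Rsubmod j N ->
  (forall i : 'I_(size e), exists s, N (j (pi ^+ s) *: e`_i)) ->
  (forall i : 'I_(size e), exists s, forall x, N x ->
     dvdpi pi j 0 (j (pi ^+ s) * coord (in_tuple e) i x)) ->
  forall x, ~ N x ->
  exists2 y, (forall z, N z -> dvdpi pi j 0 (B z y)) & ~ dvdpi pi j 0 (B x y).
Proof.
move=> NR N_full N_bnd.
have coordE z : z = \sum_(l < size e) coord (in_tuple e) l z *: e`_l.
  exact: (coord_basis (X := in_tuple e) e_basis (memvf z)).
have coord_e (i l : 'I_(size e)) : coord (in_tuple e) l e`_i = (i == l)%:R.
  exact: (coord_free (X := in_tuple e) i l (basis_free e_basis)).
have coord_Ze a (i l : 'I_(size e)) :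
    coord (in_tuple e) l (a *: e`_i) = a * (i == l)%:R.
  by rewrite linearZ /= coord_e.
(* [low s x] places [x] in the span of the first [s] basis vectors; the induction is on [s]. *)
pose low s x := forall l : 'I_(size e), (s <= l)%N -> coord (in_tuple e) l x = 0.
suff H s x : (s <= size e)%N -> low s x -> ~ N x ->
    exists2 y, (forall z, N z -> low s z -> dvdpi pi j 0 (B z y)) &
               ~ dvdpi pi j 0 (B x y).
  move=> x Nx; have lowT z : low (size e) z by move=> l; rewrite leqNgt ltn_ord.
  have [y yN yx] := H _ x (leqnn _) (lowT x) Nx.
  by exists y => // z Nz; apply: yN.
elim: s x => [|s IH] x le_s low_x Nx.
  case: Nx; rewrite (coordE x) big1; first exact: NR.1.
  by move=> l _; rewrite low_x // scale0r.
pose i := Ordinal le_s; pose c := coord (in_tuple e) i.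
have [d dE] := dual_basis B_bil B_nd e_basis i.
have low_step z : low s.+1 z -> c z = 0 -> low s z.
  move=> low_z cz l; rewrite leq_eqVlt => /predU1P [sl|]; last exact: low_z.
  by rewrite -cz; congr (coord _ _ _); apply: val_inj.
have [t bnd_t] := N_bnd i.
(* The pivot [v] has a new coordinate of least valuation: [N_bnd] bounds the denominators and
   [N_full] provides a nonzero value. *)
have [_ [v [Nv low_v <-]] [cv vdiv]] :
    exists2 a, (exists v, [/\ N v, low s.+1 v & c v = a]) &
    a != 0 /\ forall a', (exists v, [/\ N v, low s.+1 v & c v = a']) ->
       dvdpi pi j 0 (a' / a).
  apply: (dvdpi_min (s := t)) => [_ [v [Nv _ <-]]|]; first exact: bnd_t.
  have [r Nr] := N_full i.
  exists (j (pi ^+ r)); last exact: j_pi_neq0.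
  exists (j (pi ^+ r) *: e`_i); split=> [//|l lt_sl|].
    rewrite coord_Ze; by case: eqP lt_sl => [<-|]; rewrite ?ltnn ?mulr0.
  by rewrite /c (coord_Ze _ i) eqxx mulr1.
have cB z : c (z - (c z / c v) *: v) = 0.
  by rewrite /c linearB linearZ /= divfK ?subrr.
have lowB z : low s.+1 z -> low s (z - (c z / c v) *: v).
  move=> low_z; apply: low_step => // l lt_l.
  by rewrite linearB linearZ /= low_z // low_v // mulr0 subr0.
(* If [c x / c v] is not integral, the functional [z |-> c z / c v], represented by [(c v)^-1 *: d],
   already separates [x]. Otherwise the projection of [x] along [v] is still outside [N] and the
   induction applies to it. *)
have [cx|cx] := pselect (dvdpi pi j 0 (c x / c v)); last first.
  exists ((c v)^-1 *: d) => [z Nz low_z|]; rewrite (bilZr B_bil) dE mulrC //.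
  by apply: vdiv; exists z.
have NB z : dvdpi pi j 0 (c z / c v) -> N (z - (c z / c v) *: v) <-> N z.
  move=> /dvdpi0P [r ->]; split=> [Nz|Nz]; last exact: RsubmodB (RsubmodZ _ _ _).
  by rewrite -[z](subrK (j r *: v)); apply: RsubmodD (RsubmodZ _ _ _).
have [y yN yx] := IH _ (ltnW le_s) (lowB _ low_x) (fun Nx' => Nx ((NB _ cx).1 Nx')).
(* The corrected vector represents the functional that first projects [z] along [v], then pairs with
   [y]. *)
have BE z : B z (y - (B v y / c v) *: d) = B (z - (c z / c v) *: v) y.
  rewrite (bilBr B_bil) (bilBl B_bil) (bilZr B_bil) (bilZl B_bil) dE -/c.
  by congr (_ - _); rewrite [LHS]mulrC mulrCA mulrC.
exists (y - (B v y / c v) *: d) => [z Nz low_z|]; rewrite BE //.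
apply: yN; last exact: lowB.
by apply/NB => //; apply: vdiv; exists z.
Qed.

End Separation.
End Dvr.

(** A subspace of largest dimension inside [P] exhausts [P]: adding the line of any element of [P]
    stays inside [P], so it cannot raise the dimension. *)
Lemma vspace_of_pred (F : fieldType) (U : vectType F) (P : U -> Prop) :
  P 0 -> (forall c x y, P x -> P y -> P (c *: x + y)) ->
  exists S : {vspace U}, forall x, x \in S <-> P x.
Proof.
move=> P0 PL.
pose Q d := `[< exists2 S : {vspace U}, \dim S = d & forall x, x \in S -> P x >].
have exQ : exists d, Q d.
  by exists 0; apply/asboolP; exists 0%VS => [|x /vlineP [c ->]];
    rewrite ?dimv0 // scaler0.
have Q_max d : Q d -> (d <= \dim {:U})%N.
  by move=> /asboolP [S <- _]; apply/dimvS/subvf.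
case: (ex_maxnP exQ Q_max) => d /asboolP [S dS SP] d_max.
exists S => x; split=> [/SP //|Px].
have QS : Q (\dim (S + <[x]>)).
  apply/asboolP; exists (S + <[x]>)%VS => // y.
  move=> /memv_addP [u uS [v /vlineP [c ->] ->]].
  by rewrite addrC; apply: PL => //; apply: SP.
have /eqP -> : (S == S + <[x]>)%VS by rewrite eqEdim addvSl dS d_max.
by apply: (subvP (addvSr _ _)); apply: memv_line.
Qed.

(** * The lattices [F i] between [pi L] and [L] *)

Section Graded.
Context {R : idomainType} { pi : R} {K : fieldType} {j : {rmorphism R -> K}}.
Context {k : fieldType} {red : {rmorphism R -> k}}.
Context {A : algType R} {star : A -> A}.
Context {V : vectType K} {act : A -> V -> V} {B : V -> V -> K}.
Context {L : V -> Prop} {e : seq V}.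
Context {M : vectType k} {actM : A -> M -> M} {q : V -> M}.
Context {n : nat} {Ms : nat -> {vspace M}} {eps : bool}.

Hypotheses (pi_unif : is_dvr_unif pi) (j_frac : is_frac_field j).
Hypothesis red_res : is_residue_field red pi.
Hypothesis act_lin : is_Rbilinear_module j act.
Hypotheses (B_bil : bil_form B) (B_nd : nondeg_form B).
Hypothesis B_adj : star_adjoint star act B.
Hypothesis B_sym : forall x y, B x y = (-1) ^+ eps * B y x.
Hypotheses (e_basis : basis_of fullv e) (LE : forall v, L v <-> Rspan j e v).
Hypothesis L_act : forall a v, L v -> L (act a v).
Hypothesis B_int : forall x y, L x -> L y -> dvdpi pi j 0 (B x y).
Hypothesis q_red : is_reduction j red pi act L actM q.
Hypotheses (Ms0 : Ms 0%N = 0%VS) (Msn : Ms n = fullv).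
Hypothesis Ms_stable : forall i, (i <= n)%N -> Astable actM (Ms i).
Hypothesis Ms_incr :
  forall i, (i < n)%N -> (Ms i <= Ms i.+1)%VS && (Ms i != Ms i.+1).
Hypothesis Ms_simple : forall i, (i < n)%N ->
  forall U : {vspace M}, Astable actM U ->
    (Ms i <= U)%VS -> (U <= Ms i.+1)%VS -> U = Ms i \/ U = Ms i.+1.

Local Notation dvdpi := (dvdpi pi j).
Local Notation coord := (coord (in_tuple e)).

Lemma B_dvdpi_sym m x y : dvdpi m (B x y) -> dvdpi m (B y x).
Proof. by rewrite (B_sym y x) -(rmorph_sign j); apply: dvdpiM. Qed.

Lemma dvdpi_mulpi m x : dvdpi m.+1 (j pi * x) <-> dvdpi m x.
Proof. by have := dvdpi_mulX pi_unif j_frac m 1 x; rewrite addn1 expr1. Qed.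

Lemma dvdpi_mulX0 m x : dvdpi m (j (pi ^+ m) * x) <-> dvdpi 0 x.
Proof. exact: (dvdpi_mulX pi_unif j_frac 0 m x). Qed.

Lemma basis_sum x : x = \sum_(l < size e) coord l x *: e`_l.
Proof. exact: (coord_basis (X := in_tuple e) e_basis (memvf x)). Qed.

Lemma L_coord x : L x <-> forall l, dvdpi 0 (coord l x).
Proof.
rewrite LE; split=> [[c ->] l|xR].
  apply/dvdpi0P; exists (c l).
  exact: (coord_sum_free (X := in_tuple e) _ _ (basis_free e_basis)).
have /choice [c cE] : forall l, exists r, coord l x = j r.
  by move=> l; apply/dvdpi0P.
by exists c; rewrite {1}(basis_sum x); apply: eq_bigr => l _; rewrite cE.
Qed.

Lemma L_Rsub : Rsubmod j L.
Proof.
split=> [|r x y /L_coord Lx /L_coord Ly]; apply/L_coord => l.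
  by rewrite linear0; apply: dvdpix0.
by rewrite linearP /=; apply: dvdpiD => //; apply: dvdpiM.
Qed.

Lemma L_den v : exists s, L (j (pi ^+ s) *: v).
Proof.
have [|l|s sP] := uniform_bound
  (P := fun l s => dvdpi 0 (j (pi ^+ s) * coord l v)).
- move=> l m m' le_mm' mP; rewrite -(subnK le_mm') exprD rmorphM -mulrA.
  exact: dvdpiM.
- exact: dvdpi_den.
- by exists s; apply/L_coord => l; rewrite linearZ /=.
Qed.

Lemma q0 : q 0 = 0.
Proof.
case: q_red => qD _ _ _ _; have [L0 _] := L_Rsub.
by apply: (addIr (q 0)); rewrite -qD // !add0r.
Qed.

Lemma qP r x y : L x -> L y -> q (j r *: x + y) = red r *: q x + q y.
Proof.
case: q_red => qD qZ _ _ _ Lx Ly.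
by rewrite qD ?qZ //; apply: RsubmodZ L_Rsub _.
Qed.

Lemma qB x y : L x -> L y -> q (x - y) = q x - q y.
Proof.
move=> Lx Ly; rewrite addrC -scaleN1r -(rmorph1 j) -rmorphN qP //.
by rewrite rmorphN rmorph1 scaleN1r addrC.
Qed.

Lemma red_pi : red pi = 0.
Proof. by apply/red_res.2; exists 1; rewrite mulr1. Qed.

Definition F i x := L x /\ q x \in Ms i.

Lemma F_Rsub i : Rsubmod j (F i).
Proof.
split=> [|r x y [Lx qx] [Ly qy]].
  by split; [exact: L_Rsub.1 | rewrite q0 mem0v].
by split; [exact: L_Rsub.2 | rewrite qP // memvD ?memvZ].
Qed.

Lemma F_pi i x : L x -> F i (j pi *: x).
Proof.
move=> Lx; split; first exact: RsubmodZ L_Rsub _.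
by case: q_red => _ -> //; rewrite red_pi scale0r mem0v.
Qed.

Lemma F0P x : F 0 x -> exists2 y, L y & x = j pi *: y.
Proof.
rewrite /F Ms0 memv0 => -[Lx /eqP qx].
by case: q_red => _ _ _ _ /(_ x Lx) [/(_ qx) [y [Ly ->]] _]; exists y.
Qed.

Lemma FnP x : F n x <-> L x.
Proof. by rewrite /F Msn memvf; split=> [[]|]. Qed.

Lemma FL i x : F i x -> L x. Proof. by case. Qed.

Lemma FW i i' x : (i <= i')%N -> (i' <= n)%N -> F i x -> F i' x.
Proof.
elim: i' => [|i' IH]; first by rewrite leqn0 => /eqP ->.
rewrite leq_eqVlt => /predU1P [<- //|]; rewrite ltnS => le_ii' lt_i'n Fx.
have [Lx qx] := IH le_ii' (ltnW lt_i'n) Fx; split=> //.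
by have /andP [/subvP + _] := Ms_incr lt_i'n; apply.
Qed.

Lemma F_act i a x : (i <= n)%N -> F i x -> F i (act a x).
Proof.
move=> le_in [Lx qx]; split; first exact: L_act.
by case: q_red => _ _ -> // _ _; apply: Ms_stable.
Qed.

Lemma F_neq i : (i < n)%N -> exists2 x, F i.+1 x & ~ F i x.
Proof.
move=> lt_in; have /andP [le_M /negP ne_M] := Ms_incr lt_in.
apply: contrapT => noF; apply: ne_M; rewrite eqEsubv le_M /=.
apply/subvP => m mM; case: q_red => _ _ _ /(_ m) [x [Lx qx]] _.
apply: contrapT => nmM; apply: noF; exists x; first by split; rewrite ?qx.
by case=> _; rewrite qx.
Qed.

(** The image under [q] of [N + F i] is an [A]-stable subspace between [Ms i] and [Ms i.+1]. It
    differs from [Ms i] since [N] is not inside [F i], so by simplicity it is [Ms i.+1]. *)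
Lemma F_simple i (N : V -> Prop) : (i < n)%N -> Rsubmod j N ->
  (forall x, N x -> F i.+1 x) -> (forall a x, N x -> N (act a x)) ->
  (exists2 x, N x & ~ F i x) ->
  forall y, F i.+1 y -> exists2 x, N x & F i (y - x).
Proof.
move=> lt_in N_R NF N_act [x0 Nx0 nFx0].
have FiF x : F i x -> F i.+1 x by apply: FW.
have [q_D q_Z q_act q_surj q_ker] := q_red.
pose P m := exists x y, [/\ N x, F i y & m = q (x + y)].
have LD x y : N x -> F i y -> L (x + y).
  by move=> /NF /FL Lx /FL Ly; apply: RsubmodD L_Rsub _ _.
have [||U UP] := vspace_of_pred (P := P).
- by exists 0, 0; split; rewrite ?addr0 ?q0 //; [exact: N_R.1 | exact: (F_Rsub i).1].
- move=> c _ _ [x [y [Nx Fy ->]]] [x' [y' [Nx' Fy' ->]]].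
  have [r <-] := red_res.1 c.
  exists (j r *: x + x'), (j r *: y + y'); split; first exact: N_R.2.
    exact: (F_Rsub i).2.
  by rewrite addrACA -scalerDr qP //; apply: LD.
have U_stable : Astable actM U.
  move=> a m /UP [x [y [Nx Fy ->]]]; apply/UP.
  exists (act a x), (act a y); split; [exact: N_act | exact: F_act (ltnW _) _ |].
  by rewrite -q_act; [case: act_lin => _ [-> _] | exact: LD].
have Mi_U : (Ms i <= U)%VS.
  apply/subvP => m mM; apply/UP; have [y [Ly qy]] := q_surj m.
  exists 0, y; rewrite add0r qy; split=> //; first exact: N_R.1.
  by split; rewrite ?qy.
have U_Mi1 : (U <= Ms i.+1)%VS.
  apply/subvP => m /UP [x [y [Nx Fy ->]]].
  by have [] := RsubmodD (F_Rsub i.+1) (NF _ Nx) (FiF _ Fy).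
case: (Ms_simple lt_in U_stable Mi_U U_Mi1) => UE.
  case: nFx0; split; first exact: FL (NF _ Nx0).
  rewrite -UE; apply/UP; exists x0, 0; rewrite addr0; split=> //.
  exact: (F_Rsub i).1.
move=> y [Ly]; rewrite -UE => /UP [x [z [Nx Fz qyE]]]; exists x => //.
have Lx : L x by apply: FL (NF _ Nx).
split; first exact: RsubmodB L_Rsub _ _.
by rewrite qB // qyE (q_D _ _ Lx (FL Fz)) addrC addKr; case: Fz.
Qed.

(** * The dual chain and its position relative to the chain [F] *)

Definition orth i m x := forall y, F i y -> dvdpi m.+1 (B x y).
(** Since [orth i' m] is [pi^(m+1)] times the [B]-dual of [F i'], this intersects a term of the
    chain with a term of the dual chain. Modulo [pi^(m+1)], its elements pair with [F i'.+1] through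
    [F i'.+1 / F i']. *)
Definition X i i' m x := F i.+1 x /\ orth i' m x.

(* X i i' m and X i' i m are paired into pi^m R / pi^(m+1) R. *)
Definition Rel i i' m :=
  exists x y, [/\ X i i' m x, X i' i m y & ~ dvdpi m.+1 (B x y)].

Lemma orth_Rsub i m : Rsubmod j (orth i m).
Proof.
split=> [y Fy|r x x' xo x'o y Fy]; first by rewrite bil0l //; apply: dvdpix0.
rewrite bilDl // bilZl //; apply: dvdpiD; last exact: x'o.
by apply: dvdpiM; apply: xo.
Qed.

Lemma X_Rsub i i' m : Rsubmod j (X i i' m).
Proof.
have [[F0 FD] [o0 oD]] := (F_Rsub i.+1, orth_Rsub i' m).
by split=> // r x y [Fx ox] [Fy oy]; split; [apply: FD | apply: oD].
Qed.

Lemma X_act i i' m a x : (i < n)%N -> (i' < n)%N ->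
  X i i' m x -> X i i' m (act a x).
Proof.
move=> lt_in lt_i'n [Fx ox]; split; first exact: F_act.
by move=> y Fy; rewrite B_adj; apply: ox; apply: F_act => //; apply: ltnW.
Qed.

(** As [F 0 = pi L] and [F n = L], this is the periodicity of the dual chain. *)
Lemma orth0S m x : orth 0 m.+1 x <-> orth n m x.
Proof.
split=> ox y; [move=> /FnP Ly | move=> /F0P [z Lz ->]].
  by apply/dvdpi_mulpi; rewrite -bilZr //; apply/ox/F_pi.
by rewrite bilZr //; apply/dvdpi_mulpi/ox/FnP.
Qed.

Lemma orth_le i i' m x : (i' <= i)%N -> (i <= n)%N -> orth i m x -> orth i' m x.
Proof. by move=> le_i le_in ox y Fy; apply/ox/FW/Fy. Qed.

(** By periodicity the lattices [orth i m] decrease along the lexicographic order on the pairs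
    [(m, i)]. *)
Lemma orth_lex i i' m m' x : (i < n)%N -> (i' < n)%N ->
  (m < m')%N || (m == m') && (i < i')%N -> orth i' m' x -> orth i.+1 m x.
Proof.
move=> lt_i lt_i' /orP [lt_m|/andP [/eqP -> lt_ii']] ox; last first.
  by apply: orth_le (ltnW lt_i') ox.
have ox0 : orth 0 m' x by apply: orth_le ox => //; apply: ltnW.
have {}ox0 : orth 0 m.+1 x by move=> y Fy; apply: dvdpiW (ox0 y Fy).
by move/orth0S: ox0; apply: orth_le.
Qed.

(** The vector [pi y] lies in [pi L], hence in [F i'], which costs exactly one power of [pi]. *)
Lemma X_dvdpi i i' m x y : X i i' m x -> L y -> dvdpi m (B x y).
Proof.
by move=> [_ ox] Ly; apply/dvdpi_mulpi; rewrite -bilZr //; apply/ox/F_pi.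
Qed.

Lemma X_F_dvdpi i i' m x y : F i x -> X i' i m y -> dvdpi m.+1 (B x y).
Proof. by move=> Fx [_ oy]; apply/B_dvdpi_sym/oy. Qed.

Lemma Rel_sym i i' m : Rel i i' m -> Rel i' i m.
Proof.
by move=> [x [y [Xx Xy nd]]]; exists y, x; split=> // /B_dvdpi_sym.
Qed.

(** The left kernel of the pairing is [A]-stable by adjointness. If it were not inside [F i],
    simplicity would make it cover [F i.+1] modulo [F i], and the pairing would vanish, against
    [Rel]. *)
Lemma Rel_nondeg i i' m : (i < n)%N -> (i' < n)%N -> Rel i i' m ->
  forall x, X i i' m x -> (forall y, X i' i m y -> dvdpi m.+1 (B x y)) -> F i x.
Proof.
move=> lt_i lt_i' [x0 [y0 [Xx0 Xy0 nd]]] x Xx xo; apply: contrapT => nFx.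
pose N z := X i i' m z /\ forall y, X i' i m y -> dvdpi m.+1 (B z y).
have [||||z [Xz zo] Fxz] := F_simple (N := N) lt_i _ _ _ _ (proj1 Xx0).
- split=> [|r u v [Xu uo] [Xv vo]].
    split=> [|y _]; [exact: (X_Rsub _ _ _).1 | rewrite bil0l //; exact: dvdpix0].
  split=> [|y Xy]; first exact: (X_Rsub _ _ _).2.
  by rewrite bilDl // bilZl //; apply: dvdpiD; [apply/dvdpiM/uo | apply: vo].
- by move=> z [[]].
- move=> a z [Xz zo]; split=> [|y Xy]; first exact: X_act.
  by rewrite B_adj; apply/zo/X_act.
- by exists x.
apply: nd; rewrite -[x0](subrK z) bilDl //; apply: dvdpiD; last exact: zo.
exact: X_F_dvdpi Fxz Xy0.
Qed.

Lemma Rel_surj i i' m : (i < n)%N -> (i' < n)%N -> Rel i i' m ->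
  forall y, F i.+1 y -> exists2 x, X i i' m x & F i (y - x).
Proof.
move=> lt_i lt_i' [x0 [y0 [Xx0 Xy0 nd]]].
apply: F_simple => //; first exact: X_Rsub.
- by move=> x [].
- by move=> a x; apply: X_act.
by exists x0 => // Fx0; apply: nd; apply: X_F_dvdpi Fx0 Xy0.
Qed.

(** Of two candidates, take the lexicographically larger. Its witness [x] is, by [orth_lex],
    orthogonal to everything the smaller one pairs with, so [Rel_nondeg] puts [x] in [F i], where
    its pairing is trivial. *)
Lemma Rel_uniq i i1 i2 m1 m2 : (i < n)%N -> (i1 < n)%N -> (i2 < n)%N ->
  Rel i i1 m1 -> Rel i i2 m2 -> i1 = i2 /\ m1 = m2.
Proof.
move=> lt_i.
have H i3 i4 m3 m4 : (i3 < n)%N -> (i4 < n)%N ->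
    (m3 < m4)%N || (m3 == m4) && (i3 < i4)%N ->
    Rel i i3 m3 -> Rel i i4 m4 -> False.
  move=> lt_i3 lt_i4 lex Rel3 [x [y [[Fx ox] Xy nd]]].
  have ox3 : orth i3.+1 m3 x by apply: orth_lex lex ox.
  suff Fix : F i x by apply: nd; apply: X_F_dvdpi Fix Xy.
  apply: Rel_nondeg Rel3 _ _ _ => //; first by split=> //; apply: orth_le ox3.
  by move=> z [Fz _]; apply: ox3.
move=> lt_1 lt_2 Rel1 Rel2.
case: (ltngtP m1 m2) => [lt_m|lt_m|eq_m].
- by case: (H i1 i2 m1 m2); rewrite ?lt_m.
- by case: (H i2 i1 m2 m1); rewrite ?lt_m.
case: (ltngtP i1 i2) => [lt_ii|lt_ii|->] //.
- by case: (H i1 i2 m1 m2) => //; rewrite eq_m eqxx lt_ii orbT.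
- by case: (H i2 i1 m2 m1) => //; rewrite eq_m eqxx lt_ii orbT.
Qed.

Lemma F_separation i x : ~ F i x ->
  exists2 y, (forall z, F i z -> dvdpi 0 (B z y)) & ~ dvdpi 0 (B x y).
Proof.
apply: (separation pi_unif j_frac B_bil B_nd e_basis).
- exact: F_Rsub.
- move=> l; have [s Ls] := L_den e`_l; exists s.+1.
  by rewrite exprS rmorphM -scalerA; apply: F_pi.
- by move=> l; exists 0 => y [/L_coord Ly _]; rewrite expr0 rmorph1 mul1r.
Qed.

(** The hypotheses say that [x] is outside [Q = orth i'.+1 m + F i]. A vector [y] separating [x]
    from [Q], scaled by [pi^(m+1)], is the required partner of [x]. *)
Lemma Rel_crit i i' m x : (i < n)%N -> (i' < n)%N ->
  X i i' m x -> ~ F i x -> (forall z, X i i'.+1 m z -> F i z) -> Rel i i' m.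
Proof.
move=> lt_i lt_i' Xx nFx XF.
pose Q z := exists u w, [/\ orth i'.+1 m u, F i w & z = u + w].
have jS : j (pi ^+ m.+1) != 0 by apply: j_pi_neq0.
have Q_F z : F i z -> Q z.
  by move=> Fz; exists 0, z; rewrite add0r; split=> //; apply: (orth_Rsub _ _).1.
have Q_orth z : orth i'.+1 m z -> Q z.
  by move=> oz; exists z, 0; rewrite addr0; split=> //; apply: (F_Rsub _).1.
have [|l|l||y Qy xy] :=
  separation pi_unif j_frac B_bil B_nd e_basis (N := Q) _ _ _ (x := x).
- split=> [|r z z' [u [w [ou Fw ->]]] [u' [w' [ou' Fw' ->]]]].
    exact/Q_F/(F_Rsub _).1.
  exists (j r *: u + u'), (j r *: w + w'); split.
  + exact: (orth_Rsub _ _).2.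
  + exact: (F_Rsub _).2.
  + by rewrite scalerDr addrACA.
- have [s Ls] := L_den e`_l; exists s.+1; apply: Q_F.
  by rewrite exprS rmorphM -scalerA; apply: F_pi.
- have [d dE] := dual_basis B_bil B_nd e_basis l.
  (* The [l]-th coordinate of [u] is [B u d], and [pi^(s+1) d] lies in [F i'.+1], on which [u] is
     integral. *)
  have [s Ls] := L_den d; exists s.+1 => z [u [w [ou Fw ->]]].
  rewrite linearD /= mulrDr; apply: dvdpiD; last first.
    by apply: dvdpiM; apply: (L_coord w).1 (FL Fw) l.
  rewrite -dE -bilZr // exprS rmorphM -scalerA.
  by apply: dvdpiW (ou _ (F_pi _ Ls)).
- move=> [u [w [ou Fw xE]]]; apply: nFx; rewrite xE.
  apply: (RsubmodD (F_Rsub i) _ Fw); apply: XF; split=> //.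
  have -> : u = x - w by rewrite xE addrK.
  by apply: RsubmodB (F_Rsub _) Xx.1 _; apply: (FW (leqnSn i) lt_i Fw).
pose y' := j (pi ^+ m.+1) *: y.
(* Integrality of [y] on [orth i'.+1 m] places [y'] in the bidual of [F i'.+1], which is [F i'.+1]
   by [F_separation]. *)
have Fy' : F i'.+1 y'.
  apply: contrapT => /F_separation [u Fu]; apply.
  apply: B_dvdpi_sym; rewrite bilZr // -bilZl //; apply: Qy; apply: Q_orth => z Fz.
  by rewrite bilZl //; apply/dvdpi_mulX0/B_dvdpi_sym/Fu.
exists x, y'; split=> //; last first.
  by rewrite bilZr // => /dvdpi_mulX0.
split=> // z Fz; apply: B_dvdpi_sym; rewrite bilZr //.
by apply/dvdpi_mulX0/Qy/Q_F.
Qed.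

(** Coordinates are values [B x (d l)], with [pi^(s+1) d l] in [F 0]. Orthogonality at level [s.+1]
    makes those values, times [pi^(s+1)], divisible by [pi^(s+2)]; so the coordinates are divisible
    by [pi]. *)
Lemma orth_large : exists N, forall x, orth 0 N x -> F 0 x.
Proof.
have /choice [d dE] := fun l => dual_basis B_bil B_nd e_basis l.
have [|l|s sP] := uniform_bound (P := fun l s => L (j (pi ^+ s) *: d l)).
- move=> l m m' le_mm' mP; rewrite -(subnK le_mm') exprD rmorphM -scalerA.
  exact: RsubmodZ L_Rsub _.
- exact: L_den.
have jpi : j pi != 0 by have := j_pi_neq0 pi_unif j_frac 1; rewrite expr1.
exists s.+1 => x ox; rewrite -[x]scale1r -(divff jpi) -scalerA.
apply: F_pi; apply/L_coord => l; rewrite linearZ /=.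
apply/(dvdpi_mulpi 0); rewrite mulrA divff // mul1r -dE.
apply/(dvdpi_mulX pi_unif j_frac _ s); rewrite -bilZr // addnC addn1.
apply/dvdpi_mulpi; rewrite -bilZr //; exact/ox/F_pi.
Qed.

(** One looks for the last term of the dual chain whose intersection with [F i.+1] is not inside
    [F i], and applies [Rel_crit] there. *)
Lemma Rel_exists i : (i < n)%N -> exists i' m, (i' < n)%N /\ Rel i i' m.
Proof.
move=> lt_i; pose P i' m := exists2 x, X i i' m x & ~ F i x.
have [N NP] := orth_large.
(* First the level [m]: at level 0 integrality of [B] imposes no condition, while [orth_large] rules
   out level [N]. *)
have [||m [_ Pm nPm]] := nat_switch (P := P 0) (N := N).
- have [x Fx nFx] := F_neq lt_i; exists x => //; split=> // y /F0P [z Lz ->].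
  by rewrite bilZr //; apply/dvdpi_mulpi/B_int/Lz/(FL Fx).
- by move=> [x [_ /NP Fx]]; apply; apply: FW Fx => //; apply: ltnW.
(* Then the index within level [m]: failure at [(0, m.+1)] is failure at [(n, m)] by [orth0S]. *)
have [||i' [lt_i' [x Xx nFx] nP]] := nat_switch (P := P^~ m) (N := n).
- exact: Pm.
- by move=> [x [Fx ox] nFx]; apply: nPm; exists x => //; split=> //; apply/orth0S.
exists i', m; split=> //; apply: Rel_crit Xx nFx _ => // z Xz.
by apply: contrapT => nFz; apply: nP; exists z.
Qed.

Lemma residue_map : exists rho : nat -> K -> k,
  forall m r, rho m (j (pi ^+ m * r)) = red r.
Proof.
have /choice [g gP] : forall mx : nat * K, exists c : k,
    forall r, mx.2 = j (pi ^+ mx.1 * r) -> c = red r.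
  (* The residue of [pi^-m x]; outside [pi^m R] the default value is 0. *)
  move=> [m x] /=; have [[r ->]|nx] := pselect (dvdpi m x); last first.
    by exists 0 => r xE; case: nx; exists r.
  exists (red r) => s /j_frac.1 /mulfI -> //.
  by case: pi_unif => pi0 _ _; rewrite expf_neq0.
by exists (fun m x => g (m, x)) => m r; rewrite (gP (m, _) r).
Qed.

(** * The form on the semisimplification *)

Context {W : vectType k} {actW : A -> W -> W}.
Context {Ws : 'I_n -> {vspace W}} {f : 'I_n -> 'Hom(M, W)}.
Hypothesis W_mod : is_Ak_module red actW.
Hypothesis Ws_stable : forall i, Astable actW (Ws i).
Hypotheses (Ws_dir : directv (\sum_(i < n) Ws i)).
Hypotheses (Ws_full : (\sum_(i < n) Ws i)%VS = fullv).
Hypothesis f_img : forall i : 'I_n, (f i @: Ms i.+1)%VS = Ws i.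
Hypothesis f_ker : forall i : 'I_n, (lker (f i) :&: Ms i.+1)%VS = Ms i.
Hypothesis f_act : forall (i : 'I_n) a x,
  x \in Ms i.+1 -> f i (actM a x) = actW a (f i x).

Lemma gr_ker (i : 'I_n) x : F i.+1 x -> F i x <-> f i (q x) = 0.
Proof.
move=> [Lx qx]; rewrite /F -f_ker memv_cap memv_ker qx andbT.
by split=> [[_ /eqP]|->].
Qed.

Lemma gr_surj (i : 'I_n) w : w \in Ws i -> exists2 x, F i.+1 x & f i (q x) = w.
Proof.
rewrite -f_img => /memv_imgP [m mM ->].
by case: q_red => _ _ _ /(_ m) [x [Lx <-]] _ in mM *; exists x.
Qed.

Lemma gr_mem (i : 'I_n) x : F i.+1 x -> f i (q x) \in Ws i.
Proof. by case=> _ qx; rewrite -f_img memv_img. Qed.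

(** By [Rel_surj], a lift to [F i.+1] can be moved into [X i i' m] modulo [F i], the kernel of the
    map to [Ws i]. *)
Lemma gr_lift (i i' : 'I_n) m : Rel i i' m -> forall w, w \in Ws i ->
  exists2 x, X i i' m x & f i (q x) = w.
Proof.
move=> Rel_i w /gr_surj [y Fy <-].
have [x Xx Fxy] := Rel_surj (ltn_ord i) (ltn_ord i') Rel_i Fy.
have Fyx : F i.+1 (y - x) by apply: FW Fxy.
exists x => //; have := (gr_ker Fyx).1 Fxy.
rewrite (qB (FL Fy) (FL Xx.1)) linearB => /eqP.
by rewrite subr_eq0 eq_sym => /eqP.
Qed.

Lemma gr_proj : exists p : 'I_n -> W -> W,
  [/\ forall i x, p i x \in Ws i, forall x, x = \sum_i p i x &
   forall u x, (forall i, u i \in Ws i) -> x = \sum_i u i -> forall i, p i x = u i].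
Proof.
pose p (i : 'I_n) (x : W) : W := sumv_pi_for (esym Ws_full) i x.
have pW i x : p i x \in Ws i by apply: memv_sum_pi.
have pE x : x = \sum_i p i x by rewrite sumv_pi_sum ?memvf.
exists p; split=> // u x uW xE i; apply/eqP.
have := directv_sum_unique Ws_dir (fun i => p i x) u (fun i _ => pW i x)
  (fun i _ => uW i).
by rewrite -pE -xE eqxx => /esym /forall_inP; apply.
Qed.

Lemma graded_form : exists b : W -> W -> k,
  [/\ bil_form b, nondeg_form b, star_adjoint star actW b,
      forall x y, b x y = (-1) ^+ eps * b y x & alt_form B -> alt_form b].
Proof.
have [rho rhoE] := residue_map.
have rhoP m r a c : dvdpi m a -> dvdpi m c ->
    rho m (j r * a + c) = red r * rho m a + rho m c.
  move=> [a' ->] [c' ->]; rewrite -rmorphM -rmorphD mulrCA -mulrDr !rhoE.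
  by rewrite rmorphD rmorphM.
have rho0 m a : dvdpi m.+1 a -> rho m a = 0.
  move=> [r ->]; by rewrite exprSr -mulrA rhoE; apply/red_res.2; exists r.
have rho_eq0 m a : dvdpi m a -> rho m a = 0 -> dvdpi m.+1 a.
  move=> [r ->]; rewrite rhoE => /red_res.2 [s ->]; exists s.
  by rewrite exprSr -mulrA.
have rhoZ m r a : dvdpi m a -> rho m (j r * a) = red r * rho m a.
  move=> ma; have := rhoP m r a 0 ma (dvdpix0 _); rewrite !addr0 => ->.
  by rewrite (rho0 m 0) ?addr0 //; apply: dvdpix0.
have /choice [sm smP] : forall i : 'I_n, exists sm : 'I_n * nat,
    Rel i sm.1 sm.2.
  move=> i; have [i' [m [lt_i' Rel_i]]] := Rel_exists (ltn_ord i).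
  by exists (Ordinal lt_i', m).
pose s i := (sm i).1; pose mu i := (sm i).2.
have sP (i : 'I_n) : Rel i (s i) (mu i) by apply: smP.
(* [Rel_sym] makes [i] a partner of [s i] at level [mu i]; uniqueness of partners concludes. *)
have [sK mus] : involutive s /\ forall i, mu (s i) = mu i.
  suff H (i : 'I_n) : s (s i) = i /\ mu (s i) = mu i by split=> i; case: (H i).
  have := Rel_uniq (ltn_ord _) (ltn_ord _) (ltn_ord _) (sP (s i)) (Rel_sym (sP i)).
  by case=> /val_inj.
have [p [pW pE p_uniq]] := gr_proj.
have pL i c x y : p i (c *: x + y) = c *: p i x + p i y.
  apply: (p_uniq (fun l => c *: p l x + p l y)) => [l|].
    by rewrite memvD ?memvZ.
  by rewrite big_split /= -scaler_sumr -!pE.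
have act_sum a (u : 'I_n -> W) : actW a (\sum_i u i) = \sum_i actW a (u i).
  case: W_mod => _ aL _ _ _; have aD x y : actW a (x + y) = actW a x + actW a y.
    by have := aL a 1 x y; rewrite !scale1r.
  have a0 : actW a 0 = 0 by apply: (addIr (actW a 0)); rewrite -aD !add0r.
  by apply: (big_morph _ aD a0).
have p_act i a x : p i (actW a x) = actW a (p i x).
  apply: (p_uniq (fun l => actW a (p l x))) => [l|];
    by [apply: Ws_stable | rewrite -act_sum -pE].
have p_id i x : x \in Ws i -> forall l, p l x = if l == i then x else 0.
  move=> xW; apply: (p_uniq (fun l => if l == i then x else 0)) => [l|].
    by case: eqP => [->|]; rewrite ?mem0v.
  by rewrite -big_mkcond big_pred1_eq.
pose lifts (i : 'I_n) x x' := X i (s i) (mu i) x' /\ f i (q x') = p i x.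
have /choice [lam lamP] : forall ix : 'I_n * W, exists x', lifts ix.1 ix.2 x'.
  move=> [i x] /=; have [x' Xx' fx'] := gr_lift (sP i) (pW i x).
  by exists x'.
(* Component [i] of [x] is paired with component [s i] of [y]. The chosen lifts need not be
   additive; linearity and adjointness come from the independence proved in [tE]. *)
pose t i x y := rho (mu i) (B (lam (i, x)) (lam (s i, y))).
have lifts_s i y y' : lifts (s i) y y' -> X (s i) i (mu i) y'.
  by rewrite /lifts sK mus => -[].
have lifts_ker i x x' x'' : lifts i x x' -> lifts i x x'' ->
    F i (x' - x'').
  move=> [Xx' fx'] [Xx'' fx'']; apply/gr_ker.
    by apply: RsubmodB (F_Rsub _) Xx'.1 Xx''.1.
  by rewrite (qB (FL Xx'.1) (FL Xx''.1)) linearB /= fx' fx'' subrr.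
have lifts_dvdpi i x x' y y' : lifts i x x' -> lifts (s i) y y' ->
    dvdpi (mu i) (B x' y').
  by move=> [Xx' _] [[Fy' _] _]; apply: X_dvdpi Xx' (FL Fy').
have rho_congr m a c : dvdpi m c -> dvdpi m.+1 (a - c) -> rho m a = rho m c.
  move=> mc mac; have := rhoP m 1 (a - c) c (dvdpiW (leqnSn m) mac) mc.
  by rewrite (rho0 _ _ mac) rmorph1 mul1r subrK mulr0 add0r.
(* Two lifts differ by an element of [F i] (or [F (s i)]), which pairs with the opposite lift into
   [pi^(mu i + 1) R]. *)
have tE i x x' y y' : lifts i x x' -> lifts (s i) y y' ->
    t i x y = rho (mu i) (B x' y').
  move=> xx' yy'; have [xl yl] := (lamP (i, x), lamP (s i, y)).
  rewrite /t (rho_congr _ _ (B x' (lam (s i, y)))).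
  - apply: rho_congr; first exact: lifts_dvdpi xx' yy'.
    rewrite -bilBr //; apply: B_dvdpi_sym; case: xx' => Xx' _.
    exact: X_F_dvdpi (lifts_ker _ _ _ _ yl yy') Xx'.
  - exact: lifts_dvdpi xx' yl.
  - rewrite -bilBl //.
    exact: X_F_dvdpi (lifts_ker _ _ _ _ xl xx') (lifts_s _ _ _ yl).
have liftsP i r x x' y y' : lifts i x x' -> lifts i y y' ->
    lifts i (red r *: x + y) (j r *: x' + y').
  move=> [Xx' fx'] [Xy' fy']; split; first exact: (X_Rsub _ _ _).2.
  by rewrite (qP _ (FL Xx'.1) (FL Xy'.1)) linearP /= fx' fy' pL.
have lifts_act i a x x' : lifts i x x' -> lifts i (actW a x) (act a x').
  move=> [Xx' fx']; split; first exact: X_act Xx'.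
  have [_ _ q_act _ _] := q_red; rewrite (q_act _ _ (FL Xx'.1)).
  by rewrite f_act ?fx' ?p_act //; case: Xx' => [[]].
have lam_i i x : lifts i x (lam (i, x)) by apply: (lamP (i, x)).
have t_sym d : (forall x y, B x y = (-1) ^+ d * B y x) ->
    forall i x y, t (s i) y x = (-1) ^+ d * t i x y.
  move=> Bd i x y; rewrite /t sK mus Bd -(rmorph_sign j) rhoZ ?rmorph_sign //.
  exact: lifts_dvdpi (lam_i _ _) (lam_i _ _).
pose b x y := \sum_i t i x y.
have b_sym x y : b x y = (-1) ^+ eps * b y x.
  rewrite /b (reindex_inj (inv_inj sK)) mulr_sumr.
  by apply: eq_bigr => i _; apply: t_sym.
have b_linl c x y z : b (c *: x + y) z = c * b x z + b y z.
  rewrite /b mulr_sumr -big_split; apply: eq_bigr => i _ /=.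
  have [r <-] := red_res.1 c.
  rewrite (tE _ _ _ _ _ (liftsP _ _ _ _ _ _ (lam_i i x) (lam_i i y)) (lam_i _ z)).
  by rewrite bilDl // bilZl // rhoP //; apply: lifts_dvdpi (lam_i _ _) (lam_i _ _).
have b_nd x : (forall y, b x y = 0) -> x = 0.
  move=> bx; rewrite (pE x) big1 // => i _.
  have [Xx <-] := lam_i i x; apply/gr_ker; first exact: Xx.1.
  apply: (Rel_nondeg _ _ (sP i)) => // y Xy.
  have Xsy : X (s i) (s (s i)) (mu (s i)) y by rewrite sK mus.
  (* The test vector [w] sits in the summand [Ws (s i)] only, so every term other than the [i]-th
     vanishes, 0 being a lift of the missing components. *)
  pose w := f (s i) (q y).
  have wW : w \in Ws (s i) by apply: gr_mem Xy.1.
  apply: rho_eq0; first exact: X_dvdpi Xx (FL Xy.1).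
  have := bx w; rewrite /b (bigD1 i) //= big1 => [|l ne_li].
    rewrite addr0 => <-; rewrite (tE _ x (lam (i, x)) w y) //.
    by split=> //; rewrite (p_id _ _ wW) eqxx.
  rewrite (tE _ x (lam (l, x)) w 0) ?bil0r ?rho0 //; first exact: dvdpix0.
  split; first exact: (X_Rsub _ _ _).1.
  by rewrite q0 linear0 (p_id _ _ wW) (inj_eq (inv_inj sK)) (negPf ne_li).
exists b; split=> //.
- split=> // c x y z; rewrite ![b x _]b_sym b_linl mulrDr mulrCA.
  by congr (_ + _).
- by split=> // y by0; apply: b_nd => x; rewrite b_sym by0 mulr0.
- move=> a x y; apply: eq_bigr => i _.
  rewrite (tE _ _ _ _ _ (lifts_act _ a _ _ (lam_i i x)) (lam_i _ y)) B_adj.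
  by rewrite -(tE _ _ _ _ _ (lam_i i x) (lifts_act _ _ _ _ (lam_i _ y))).
move=> B_alt x; have tN i : t (s i) x x = - t i x x.
  rewrite (t_sym true) ?mulN1r // => u v.
  by rewrite mulN1r; apply: alt_formN.
apply: (sum_involution sK tN) => i si.
(* At a fixed point of [s] the same lift serves on both sides, so alternation of [B] applies
   directly. *)
rewrite (tE i x (lam (i, x)) x (lam (i, x))) ?si //.
by rewrite B_alt rho0 //; apply: dvdpix0.
Qed.

End Graded.

(** * Clearing denominators, and the theorem *)

Lemma form_den (R : idomainType) (pi : R) (K : fieldType)
    (j : {rmorphism R -> K}) (V : vectType K) (B : V -> V -> K) (e : seq V) :
  is_dvr_unif pi -> is_frac_field j -> bil_form B ->
  exists s, forall x y, Rspan j e x -> Rspan j e y ->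
    dvdpi pi j 0 (j (pi ^+ s) * B x y).
Proof.
move=> pi_unif j_frac B_bil.
have [|u|s sP] := uniform_bound (P := fun (u : 'I_(size e) * 'I_(size e)) s =>
    dvdpi pi j 0 (j (pi ^+ s) * B e`_u.1 e`_u.2)).
- move=> u m m' le_mm' mP; rewrite -(subnK le_mm') exprD rmorphM -mulrA.
  exact: dvdpiM.
- exact: dvdpi_den.
exists s => x y [c ->] [d ->]; rewrite bil_suml // mulr_sumr.
apply: (big_ind (dvdpi pi j 0)) => [||i _];
  [exact: dvdpix0 | by move=> *; apply: dvdpiD |].
rewrite bilZl // mulrCA; apply: dvdpiM.
rewrite (big_morph (B e`_i) (bilDr B_bil e`_i) (bil0r B_bil e`_i)) mulr_sumr.
apply: (big_ind (dvdpi pi j 0)) => [||l _];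
  [exact: dvdpix0 | by move=> *; apply: dvdpiD |].
by rewrite bilZr // mulrCA; apply: dvdpiM; apply: (sP (i, l)).
Qed.

Theorem theorem5p1p4
  (R : idomainType) (pi : R) (K : fieldType) (j : {rmorphism R -> K})
  (k : fieldType) (red : {rmorphism R -> k})
  (A : algType R) (star : A -> A)
  (V : vectType K) (act : A -> V -> V) (B : V -> V -> K) :
  is_dvr_unif pi -> is_frac_field j -> is_residue_field red pi ->
  is_involution star ->
  is_Rbilinear_module j act ->
  (exists L : V -> Prop, is_A_lattice j act L) ->
  bil_form B -> nondeg_form B -> star_adjoint star act B ->
  (alt_form B \/ (sym_form B /\ (2%:R : k) != 0)) ->
  (* V_k: the semisimplification of L / pi L, for any A-lattice L *)
  forall L : V -> Prop, is_A_lattice j act L ->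
  forall (M : vectType k) (actM : A -> M -> M) (q : V -> M),
    is_reduction j red pi act L actM q ->
  forall (Vk : vectType k) (actk : A -> Vk -> Vk),
    is_Ak_module red actk -> is_semisimplification actM actk ->
  exists b : Vk -> Vk -> k,
    [/\ bil_form b, nondeg_form b, star_adjoint star actk b,
        alt_form B -> alt_form b &
        sym_form B -> sym_form b].
Proof.
move=> pi_unif j_frac red_res star_inv act_lin _ B_bil B_nd B_adj B_eps.
move=> L [[e [e_basis LE]] L_act] M actM q q_red W actW W_mod.
move=> [n [Ms [Ws [f [Ms0 [Msn [Ms_st [Ms_incr [Ms_simple [Ws_st [Ws_dir
  [Ws_full fP]]]]]]]]]]]].
have [a aP] := form_den e pi_unif j_frac B_bil.
have ja0 : j (pi ^+ a) != 0 by apply: j_pi_neq0.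
(* Scaling by a power of [pi] makes the form integral on [L] and preserves nondegeneracy,
   adjointness and symmetry type. *)
pose B' x y := j (pi ^+ a) * B x y.
have B'_bil : bil_form B'.
  by split=> c x y z; rewrite /B' ?B_bil.1 ?B_bil.2 mulrDr mulrCA.
have B'_nd : nondeg_form B'.
  split=> x Bx0; [apply: B_nd.1 | apply: B_nd.2] => y;
    by have /eqP := Bx0 y; rewrite mulf_eq0 (negPf ja0) => /eqP.
have B'_adj : star_adjoint star act B' by move=> c x y; rewrite /B' B_adj.
have B'_int x y : L x -> L y -> dvdpi pi j 0 (B' x y).
  by move=> /LE Lx /LE Ly; apply: aP.
(* Symmetry is tested first, so that a form both symmetric and alternating gets the sign [+1];
   alternation of [b] is obtained separately from the sign. *)
have [eps [B_sym sym_eps]] : exists eps : bool,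
    (forall x y, B x y = (-1) ^+ eps * B y x) /\ (sym_form B -> eps = false).
  have [Bs|nBs] := pselect (sym_form B).
    by exists false; split=> // x y; rewrite mul1r.
  exists true; split=> // x y; rewrite mulN1r.
  by case: B_eps => [B_alt|[]//]; apply: alt_formN.
have B'_sym x y : B' x y = (-1) ^+ eps * B' y x.
  by rewrite /B' B_sym mulrCA.
have [b [b_bil b_nd b_adj b_sym b_alt]] := graded_form pi_unif j_frac red_res
  act_lin B'_bil B'_nd B'_adj B'_sym e_basis LE L_act B'_int q_red Ms0 Msn Ms_st
  Ms_incr Ms_simple W_mod Ws_st Ws_dir Ws_full (fun i => (fP i).1)
  (fun i => (fP i).2.1) (fun i => (fP i).2.2).
exists b; split=> // [B_alt|/sym_eps eps0 x y].
  by apply: b_alt => x; rewrite /B' B_alt mulr0.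
by rewrite b_sym eps0 mul1r.
Qed.
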